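(* Let $n\ge1$ and $S\in\mathbb{R}$. The family of Poisson commuting Hamiltonians $H_0,\dots,H_n$ defined from the $2\times2$ Lax matrices $L_i(u)$ by $T_{11}(u)=\sum_{i=0}^n(-1)^iH_iu^{n-i}$, where $T(u)=L_n(u)\cdots L_1(u)$, coincides with the family generated by the characteristic polynomial of the $n\times n$ Lax matrix $L=(L_{ij})_{i,j=1}^n$; that is, $$\det_{n\times n}\left(u\,\mathrm{id}_{n\times n}-L\right)=T_{11}(u).$$
   Context: The phase space is $(\mathbb{R}^\times)^n\times\mathbb{R}^n$ with coordinates $x_1,\dots,x_n$ ($x_i\neq0$) and momenta $p_1,\dots,p_n$, and Poisson bracket $\{p_i,p_j\}=\{x_i,x_j\}=0$, $\{p_i,x_j\}=\delta_{ij}x_i$; all entries are commuting functions. The $2\times2$ Lax matrices are $$L_i(u)=\begin{pmatrix}u-p_i&(1-Sp_i)x_i^{-1}\\(1+Sp_i)x_i&S^2(u+p_i)\end{pmatrix},\qquad i=1,\dots,n,$$ and $T_{11}(u)$ is the upper-left entry of $T(u)=L_n(u)\cdots L_1(u)$. The $n\times n$ Lax matrix has entries $$L_{ij}=\delta_{ij}\,p_i+\delta_{i<j}\,S^{j-i-1}(Sp_j-1)\frac{x_i}{x_j}+\delta_{i>j}\,S^{i-j-1}(Sp_j+1),$$ where $\delta_{i<j}$ is $1$ if $i<j$ and $0$ otherwise (similarly $\delta_{i>j}$), and $S^0=1$ also for $S=0$. *)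

(* Defs.v *)
From HB Require Import structures.
From mathcomp Require Import all_boot all_order all_algebra.
From mathcomp Require Import all_classical all_reals topology normedtype derive.

Set Implicit Arguments.
Unset Strict Implicit.
Unset Printing Implicit Defensive.

Import Order.TTheory GRing.Theory Num.Theory.
Import numFieldNormedType.Exports.

Local Open Scope ring_scope.

(* Sites are numbered from 0 to n - 1. A point of the phase space is a pair
   (x, p) of row vectors with all x_i nonzero; functions on the phase space are
   represented by total functions of (x, p), considered only on that open set. *)
Definition in_phase_space (R : realType) (n : nat) (x p : 'rV[R]_n) : Prop :=
  forall i, x 0 i != 0.

(* The bracket of smooth functions determined by {p_i, p_j} = {x_i, x_j} = 0
   and {p_i, x_j} = delta_ij x_i. *)
Definition poisson (R : realType) (n : nat) (f g : 'rV[R]_n -> 'rV[R]_n -> R)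
    (x p : 'rV[R]_n) : R :=
  \sum_(i < n) x 0 i *
    ('D_(delta_mx 0 i) (fun q => f x q) p * 'D_(delta_mx 0 i) (fun y => g y p) x
   - 'D_(delta_mx 0 i) (fun y => f y p) x * 'D_(delta_mx 0 i) (fun q => g x q) p).

Definition mx2 (A : Type) (a b c d : A) : 'M[A]_2 :=
  \matrix_(i, j) if i == 0 then (if j == 0 then a else b)
                 else (if j == 0 then c else d).

(* The spectral parameter u is the polynomial indeterminate. *)
Definition Lsite (R : realType) (n : nat) (S : R) (x p : 'rV[R]_n) (i : 'I_n) :
    'M[{poly R}]_2 :=
  mx2 ('X - (p 0 i)%:P)             ((1 - S * p 0 i) * (x 0 i)^-1)%:P
      ((1 + S * p 0 i) * x 0 i)%:P  (S ^+ 2 *: ('X + (p 0 i)%:P)).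

(* L_n ... L_1: the last site is the leftmost factor. *)
Definition monodromy (R : realType) (n : nat) (S : R) (x p : 'rV[R]_n) :
    'M[{poly R}]_2 :=
  \prod_(i < n) Lsite S x p (rev_ord i).

Definition T11 (R : realType) (n : nat) (S : R) (x p : 'rV[R]_n) : {poly R} :=
  monodromy S x p 0 0.

(* The coefficient c_i in P(u) = \sum_(i <= n) (-1)^i c_i u^(n - i). *)
Definition signed_coef (R : realType) (n : nat) (P : {poly R}) (i : nat) : R :=
  (-1) ^+ i * P`_(n - i).

Definition hamiltonian (R : realType) (n : nat) (S : R) (i : nat)
    (x p : 'rV[R]_n) : R :=
  signed_coef n (T11 S x p) i.

Definition Lax (R : realType) (n : nat) (S : R) (x p : 'rV[R]_n) : 'M[R]_n :=
  \matrix_(i, j)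
    if (i < j)%N then S ^+ (j - i - 1) * (S * p 0 j - 1) * (x 0 i / x 0 j)
    else if (j < i)%N then S ^+ (i - j - 1) * (S * p 0 j + 1)
    else p 0 i.

(* Main.v *)
(**
The Hamiltonians commute because each L_i satisfies the Yangian relation
(u - v) {L(u) (x) L(v)} = [P, L(u) (x) L(v)], which survives products of matrices
on distinct sites; its (11,11) entry gives {T_11(u), T_11(v)} = 0.

For the spectral identity (sites numbered from 0), put A_n = u - L and let w_n, r_n be the column
S^(n-1-i) x_i and the row - S^(n-1-j) (S p_j + 1). Then A_(n+1) is A_n bordered
by a multiple of w_n, by r_n and by u - p_n, so det A_(n+1) is a combination of
det A_n and of - r_n adj(A_n) w_n. The pair (det A_n, - r_n adj(A_n) w_n) obeys
the recursion of the first column (T_11, T_21) of T(u).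
*)

Require Import Defs.
From HB Require Import structures.
From mathcomp Require Import all_boot all_order all_algebra.
From mathcomp Require Import all_classical all_reals topology normedtype derive.
From mathcomp Require Import ring.

Set Implicit Arguments.
Unset Strict Implicit.
Unset Printing Implicit Defensive.

Import Order.TTheory GRing.Theory Num.Theory.
Import numFieldNormedType.Exports.

Local Open Scope ring_scope.

(** * Ordered products of two by two matrices and the Yangian relation *)

Section Transfer.
Variable K : comNzRingType.
Implicit Types (L : nat -> 'M[K]_2) (E : 'M[K]_2).

Fixpoint transfer L n : 'M[K]_2 :=
  if n is m.+1 then L m *m transfer L m else 1%:M.

(* The derivative of [transfer L n] in the direction E at site k. It is also the
   exact increment, as each site occurs once. *)
Fixpoint variation L k E n : 'M[K]_2 :=
  if n is m.+1 then
    if k == m then E *m transfer L m else L m *m variation L k E m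
  else 0.

Lemma variation_ge L k E n : (n <= k)%N -> variation L k E n = 0.
Proof.
elim: n => //= n IHn lt_nk.
by rewrite gtn_eqF // IHn ?mulmx0 // ltnW.
Qed.

Lemma variationP L k a b E1 E2 n :
  variation L k (a *: E1 + b *: E2) n =
  a *: variation L k E1 n + b *: variation L k E2 n.
Proof.
elim: n => [|n IHn] /=; first by rewrite !scaler0 addr0.
case: eqP => _; first by rewrite mulmxDl !scalemxAl.
by rewrite IHn mulmxDr !scalemxAr.
Qed.

Lemma transfer_perturb L L' k E n :
    (forall m, (m < n)%N -> L' m = L m + (if k == m then E else 0)) ->
  transfer L' n = transfer L n + variation L k E n.
Proof.
elim: n => [|n IHn] L'E /=; first by rewrite addr0.
rewrite IHn => [|m lt_mn]; last by rewrite L'E // ltnW.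
rewrite L'E //; case: eqP => [<-|_]; last by rewrite addr0 mulmxDr.
by rewrite variation_ge // addr0 mulmxDl.
Qed.

Lemma mulmx2E (A B : 'M[K]_2) i j :
  (A *m B) i j = A i 0 * B 0 j + A i 1 * B 1 j.
Proof.
rewrite mxE !big_ord_recl big_ord0 addr0.
by congr (_ + A i _ * B _ j); apply/val_inj.
Qed.

(* The Yangian relation in coordinates: c = u - v, L1 and L2 are L(u) and L(v),
   P1, P2 their p-derivatives and X1, X2 their x d/dx-derivatives. *)
Lemma rtt_transfer (c : K) (L1 L2 P1 P2 X1 X2 : nat -> 'M[K]_2) n :
    (forall s i j k l,
      c * (P1 s i j * X2 s k l - X1 s i j * P2 s k l) =
      L1 s k j * L2 s i l - L2 s k j * L1 s i l) ->
  forall i j k l,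
  c * (\sum_(s < n) (variation L1 s (P1 s) n i j * variation L2 s (X2 s) n k l
                   - variation L1 s (X1 s) n i j * variation L2 s (P2 s) n k l))
  = transfer L1 n k j * transfer L2 n i l - transfer L2 n k j * transfer L1 n i l.
Proof.
move=> site_rtt; elim: n => [|n IHn] i j k l.
  by rewrite big_ord0 mulr0 subrr.
rewrite big_ord_recr /= eqxx.
set S0 := \sum_(s < n) _.
pose B a b := \sum_(s < n)
  (variation L1 s (P1 s) n a j * variation L2 s (X2 s) n b l
 - variation L1 s (X1 s) n a j * variation L2 s (P2 s) n b l).
have -> : S0 = L1 n i 0 * L2 n k 0 * B 0 0 + L1 n i 0 * L2 n k 1 * B 0 1
             + (L1 n i 1 * L2 n k 0 * B 1 0 + L1 n i 1 * L2 n k 1 * B 1 1).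
  rewrite /B !mulr_sumr -!big_split /=; apply: eq_bigr => s _.
  by rewrite ltn_eqF // !mulmx2E; ring.
have IH a b := IHn a j b l; rewrite -/(B _ _) in IH.
rewrite !mulmx2E.
set T1 := transfer L1 n in IH *; set T2 := transfer L2 n in IH *.
(* The sites below [n] contribute the four brackets [c * B a b], site [n] its own bracket. After
   substituting both relations, the terms [L1 n i a * L2 n k b * (T1 b j * T2 a l)] cancel between
   the two groups. *)
transitivity (
   L1 n i 0 * L2 n k 0 * (c * B 0 0) + L1 n i 0 * L2 n k 1 * (c * B 0 1)
 + (L1 n i 1 * L2 n k 0 * (c * B 1 0) + L1 n i 1 * L2 n k 1 * (c * B 1 1))
 + (c * (P1 n i 0 * X2 n k 0 - X1 n i 0 * P2 n k 0)) * (T1 0 j * T2 0 l)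
 + (c * (P1 n i 0 * X2 n k 1 - X1 n i 0 * P2 n k 1)) * (T1 0 j * T2 1 l)
 + (c * (P1 n i 1 * X2 n k 0 - X1 n i 1 * P2 n k 0)) * (T1 1 j * T2 0 l)
 + (c * (P1 n i 1 * X2 n k 1 - X1 n i 1 * P2 n k 1)) * (T1 1 j * T2 1 l)).
  by ring.
by rewrite !IH !site_rtt; ring.
Qed.

(* y stands for the inverse of x. *)
Definition site (u S p x y : K) : 'M[K]_2 :=
  mx2 (u - p) ((1 - S * p) * y) ((1 + S * p) * x) (S ^+ 2 * (u + p)).

Definition site_dp (S x y : K) : 'M[K]_2 := mx2 (-1) (- (S * y)) (S * x) (S ^+ 2).

(* The derivation x d/dx applied to [site]. *)
Definition site_dx (S p x y : K) : 'M[K]_2 :=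
  mx2 0 (- ((1 - S * p) * y)) ((1 + S * p) * x) 0.

(** Each of the sixteen entries is a polynomial identity modulo [x * y = 1], so the relation is
    available over [{poly {poly R}}]. *)
Lemma rtt_site (u v S p x y : K) i j k l : x * y = 1 ->
  (u - v) * (site_dp S x y i j * site_dx S p x y k l
           - site_dx S p x y i j * site_dp S x y k l) =
  site u S p x y k j * site v S p x y i l - site v S p x y k j * site u S p x y i l.
Proof.
move=> xy; rewrite /site /site_dp /site_dx !mxE.
case: i => [[|[|//]] ?]; case: j => [[|[|//]] ?]; case: k => [[|[|//]] ?];
  case: l => [[|[|//]] ?] /=; ring: xy.
Qed.

End Transfer.

(** * Transport along ring morphisms *)

Lemma map_mx2 (A B : Type) (f : A -> B) a b c d :
  map_mx f (mx2 a b c d) = mx2 (f a) (f b) (f c) (f d).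
Proof. by apply/matrixP => i j; rewrite !mxE; do 2!case: ifP. Qed.

Section TransferMorphism.
Variables (K K' : comNzRingType) (f : {rmorphism K -> K'}).

Lemma map_transfer (L : nat -> 'M[K]_2) n :
  map_mx f (transfer L n) = transfer (fun k => map_mx f (L k)) n.
Proof. by elim: n => [|n IHn] /=; rewrite ?map_mx1 // map_mxM IHn. Qed.

Lemma map_variation (L : nat -> 'M[K]_2) k E n :
  map_mx f (variation L k E n) =
  variation (fun k => map_mx f (L k)) k (map_mx f E) n.
Proof.
elim: n => [|n IHn] /=; first by rewrite map_mx0.
by case: eqP => _; rewrite map_mxM ?map_transfer ?IHn.
Qed.

Lemma map_site u S p x y :
  map_mx f (site u S p x y) = site (f u) (f S) (f p) (f x) (f y).
Proof. by rewrite map_mx2 !(rmorphB, rmorphD, rmorphM, rmorph1, rmorphXn). Qed.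

Lemma map_site_dp S x y :
  map_mx f (site_dp S x y) = site_dp (f S) (f x) (f y).
Proof. by rewrite map_mx2 !(rmorphN, rmorphM, rmorph1, rmorphXn). Qed.

Lemma map_site_dx S p x y :
  map_mx f (site_dx S p x y) = site_dx (f S) (f p) (f x) (f y).
Proof. by rewrite map_mx2 !(rmorphN, rmorphB, rmorphD, rmorphM, rmorph1, rmorph0). Qed.

End TransferMorphism.

(** * Bordered determinants and adjugates *)

Section Bordered.
Variables (D : idomainType) (n : nat).
Variables (A : 'M[D]_n) (w : 'cV[D]_n) (r : 'rV[D]_n).

(** This is the determinant of [A] bordered by [w], [r] and a zero corner. *)
Definition border : D := - (r *m \adj A *m w) 0 0.

Lemma det_bordered (c z : D) : \det A != 0 ->
  \det (block_mx A (c *: w) r z%:M) = z * \det A + c * border.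
Proof.
move=> dA0; apply: (mulIf dA0).
(* Right multiplication by [U] clears the upper right block: a Schur complement without
   denominators. *)
pose U := block_mx 1%:M (- (c *: (\adj A *m w))) 0 (\det A)%:M.
have detU : \det U = \det A.
  by rewrite /U (@det_ublock _ n 1) det1 mul1r det_scalar1.
rewrite -{1}detU -det_mulmx /U mulmx_block !mulmx1 !mulmx0 !addr0.
rewrite mulmxN -scalemxAr mulmxA mul_mx_adj mul_scalar_mx.
rewrite mul_mx_scalar !scalerA (mulrC c) addNr det_lblock mulrC; congr (_ * _).
rewrite mulmxN -scalemxAr mulmxA mul_mx_scalar det_mx11 /border.
by set q := r *m _ *m w; rewrite !mxE /= mulr1n; ring.
Qed.

Lemma adj_bordered_row (c z : D) :
    \det (block_mx A (c *: w) r z%:M) != 0 -> \det A != 0 ->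
  row_mx 0 1%:M *m \adj (block_mx A (c *: w) r z%:M) =
  row_mx (- (r *m \adj A)) (\det A)%:M.
Proof.
set A' := block_mx _ _ _ _ => dA'0 dA0.
have key : row_mx (- (r *m \adj A)) (\det A)%:M *m A' = (\det A') *: row_mx 0 1%:M.
  rewrite det_bordered // /A' mul_row_block !mulNmx -scalemxAr /border.
  set q := r *m _ *m w; rewrite -mulmxA mul_adj_mx mul_mx_scalar mul_scalar_mx.
  rewrite addNr mul_scalar_mx scale_row_mx scaler0; congr row_mx.
  by apply/matrixP => i j; rewrite !ord1 !mxE /= !mulr1n; ring.
apply: (scalemx_inj dA'0); rewrite scalemxAl -key -mulmxA mul_mx_adj.
by rewrite mul_mx_scalar.
Qed.

End Bordered.

(* The last row of the bordered matrix of order n + 1 is b times its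
   predecessor up to a correction supported on the last entry. *)
Lemma border_bordered (D : idomainType) n (A : 'M[D]_n) (w : 'cV[D]_n) (r : 'rV[D]_n)
    (b c z t x : D) :
    \det A != 0 -> \det (block_mx A (c *: w) r z%:M) != 0 ->
  border (block_mx A (c *: w) r z%:M) (col_mx (b *: w) x%:M)
         (row_mx (b *: r) t%:M) =
  (b * z - t) * (b * border A w r + x * \det A)
    - b * x * (z * \det A + c * border A w r).
Proof.
move=> dA0 dA'0; rewrite -(det_bordered w r c z) //.
rewrite {1}/border; set A' := block_mx _ _ _ _ in dA'0 *.
(* The last row of [A'] times [\adj A'] collapses to [\det A'] times the last unit row, so only the
   last row of the adjugate is needed. *)
have -> : row_mx (b *: r) t%:M =
  b *: (row_mx 0 1%:M *m A') + (t - b * z) *: row_mx 0 1%:M.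
  rewrite /A' mul_row_block !mul0mx !mul1mx !add0r !scale_row_mx add_row_mx.
  rewrite scaler0 addr0; congr row_mx.
  by apply/matrixP => i j; rewrite !ord1 !mxE; ring.
rewrite mulmxDl -!scalemxAl -mulmxA mul_mx_adj mul_mx_scalar.
rewrite adj_bordered_row // mulmxDl -!scalemxAl !mul_row_col mul0mx add0r mul1mx.
rewrite mulNmx -!scalemxAr /border.
by set q := r *m _ *m w; rewrite mul_scalar_mx !mxE /= !mulr1n; ring.
Qed.

(** * The characteristic polynomial as a monodromy entry *)

Section SpectralCurve.
Variables (R : realType) (S : R) (x p : nat -> R).

(* Sites indexed by nat, so that adding the last site is a recursion on n. *)
Definition chain (k : nat) : 'M[{poly R}]_2 :=
  site 'X S%:P (p k)%:P (x k)%:P (x k)^-1%:P.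

Definition lax n : 'M[R]_n :=
  \matrix_(i, j)
    if (i < j)%N then S ^+ (j - i - 1) * (S * p j - 1) * (x i / x j)
    else if (j < i)%N then S ^+ (i - j - 1) * (S * p j + 1)
    else p i.

Definition lax_col n : 'cV[{poly R}]_n := \col_i (S ^+ (n - i - 1) * x i)%:P.
Definition lax_row n : 'rV[{poly R}]_n :=
  \row_j (- (S ^+ (n - j - 1) * (S * p j + 1)))%:P.

Lemma char_poly_mx_lax n :
  char_poly_mx (lax (n + 1)) =
  block_mx (char_poly_mx (lax n)) (((1 - S * p n) / x n)%:P *: lax_col n)
           (lax_row n) ('X - (p n)%:P)%:M.
Proof.
apply/matrixP => i j; rewrite [LHS]mxE [RHS]mxE.
case: (splitP i) => i' ei; rewrite [RHS]mxE; case: (splitP j) => j' ej;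
  rewrite !mxE -?val_eqE /= ei ej ?ord1 ?addn0 ?ltnn ?eqxx ?mulr1n //.
- rewrite ltn_ord ltn_eqF // mulr0n sub0r -polyCM -polyCN; congr _%:P; ring.
- by rewrite ltnNge (ltnW (ltn_ord j')) ltn_ord gtn_eqF ?ltn_ord // mulr0n sub0r -polyCN.
Qed.

Lemma lax_colS n :
  lax_col (n + 1) = col_mx (S%:P *: lax_col n) (x n)%:P%:M.
Proof.
apply/matrixP => i j; rewrite ord1 [LHS]mxE [RHS]mxE.
case: (splitP i) => i' ->; rewrite !mxE.
  by rewrite -polyCM mulrA -exprS -addnBAC 1?ltnW // addnK -subnDA addn1 -subSn // subn1.
by rewrite !ord1 addn0 addKn /= expr0 mul1r mulr1n.
Qed.

Lemma lax_rowS n :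
  lax_row (n + 1) = row_mx (S%:P *: lax_row n) (- (S * p n + 1))%:P%:M.
Proof.
apply/matrixP => i j; rewrite ord1 [LHS]mxE [RHS]mxE.
case: (splitP j) => j' ->; rewrite !mxE.
  by rewrite -polyCM mulrN mulrA -exprS -addnBAC 1?ltnW // addnK -subnDA addn1 -subSn // subn1.
by rewrite !ord1 addn0 addKn /= expr0 mul1r mulr1n.
Qed.

(** Both entries of the first column are carried along, since the new site matrix mixes them. *)
Lemma transfer_char_poly n : (forall k, (k < n)%N -> x k != 0) ->
  transfer chain n 0 0 = char_poly (lax n) /\
  transfer chain n 1 0 = border (char_poly_mx (lax n)) (lax_col n) (lax_row n).
Proof.
elim: n => [|n IHn] x_neq0.
  by rewrite /char_poly det_mx00 /border !mxE big_ord0 oppr0.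
have [k lt_kn|T00 T10] := IHn; first by apply: x_neq0; rewrite ltnW.
(* Working over [{poly R}] makes these determinants monic, hence nonzero, as the bordered lemmas
   require. *)
have d_neq0 m : \det (char_poly_mx (lax m)) != 0.
  exact/monic_neq0/char_poly_monic.
have xn0 := x_neq0 n (ltnSn n).
have d1_neq0 := d_neq0 (n + 1)%N; have d0_neq0 := d_neq0 n.
(* [e] makes the order a single argument, so that [n.+1] can be replaced by the [n + 1] of block
   matrices. *)
pose e m := border (char_poly_mx (lax m)) (lax_col m) (lax_row m).
rewrite -[border _ _ _]/(e n.+1) -[in char_poly _]addn1 -[in e _]addn1 /e.
rewrite lax_colS lax_rowS /char_poly char_poly_mx_lax in d1_neq0 *.
rewrite border_bordered // det_bordered //.
rewrite /= !mulmx2E T00 T10 /char_poly !mxE /=.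
have xV : (x n)%:P * (x n)^-1%:P = 1 by rewrite -polyCM divff.
rewrite !(polyCN, polyCD, polyCM, polyCB).
split; first by ring.
ring: xV.
Qed.

End SpectralCurve.

(** * Differentiation and Poisson commutation of the Hamiltonians *)

Lemma derive_affine_inv (R : realType) (V : normedModType R) (f : V -> R)
    (a e : V) (y b c : R) : y != 0 ->
    (forall h, f (h *: e + a) = f a + b * h + c * ((y + h)^-1 - y^-1)) ->
  'D_e f a = b - c / y ^+ 2.
Proof.
move=> y0 fE.
rewrite /derive; apply: cvg_lim => //.
(* For small nonzero [h] the difference quotient equals this function, which is continuous at 0. *)
apply: (@cvg_trans _ ((fun h : R => b - c * (y * (y + h))^-1) @ 0^')%classic).
  apply: near_eq_cvg; near=> h.
  have h0 : h != 0 by near: h; exact: nbhs_dnbhs_neq.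
  have yh0 : y + h != 0.
    near: h; apply: nbhs_dnbhs.
    have : ((fun h => y + h) @ (0 : R) --> y + 0)%classic.
      by apply: cvgD; [exact: cvg_cst|exact: cvg_id].
    by move=> /cvgr_neq0 cvg_neq0; apply: cvg_neq0; rewrite addr0.
  rewrite /= fE -[RHS]/(_ * _); field.
  by rewrite h0 yh0 y0.
have -> : b - c / y ^+ 2 = b - c * (y * (y + 0))^-1 by rewrite addr0 expr2.
apply: cvg_within_filter.
apply: cvgB; first exact: cvg_cst.
apply: cvgM; first exact: cvg_cst.
apply: cvgV; first by rewrite addr0 mulf_neq0.
apply: cvgM; first exact: cvg_cst.
by apply: cvgD; [exact: cvg_cst|exact: cvg_id].
Unshelve. all: by end_near.
Qed.

Section Involution.
Variables (R : realType) (S : R) (n : nat).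
Implicit Types x p : 'rV[R]_n.+1.

(* Beyond n the entries are junk (those of site 0), and never used. *)
Definition coords x (k : nat) : R := x 0 (inord k).

Definition sites x p := chain S (coords x) (coords p).

Lemma monodromyE x p : monodromy S x p = transfer (sites x p) n.+1.
Proof.
rewrite /monodromy.
have prod_transfer (L : nat -> 'M[{poly R}]_2) m :
    \prod_(i < m) L (m - i.+1)%N = transfer L m.
  elim: m => [|m IHm]; first by rewrite big_ord0.
  by rewrite big_ord_recl subn1 /= -mulmxE -IHm.
transitivity (\prod_(i < n.+1) sites x p (n.+1 - i.+1)%N); last exact: prod_transfer.
apply: eq_bigr => i _.
rewrite /Lsite /sites /chain /site /coords /=.
have -> : inord (n.+1 - i.+1) = rev_ord i.
  by apply/val_inj; rewrite /= inordK // subSS ltnS leq_subr.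
by rewrite !(polyCM, polyCB, polyCD) -mul_polyC polyC_exp.
Qed.

Definition dT_dp x p (k : 'I_n.+1) : {poly R} :=
  variation (sites x p) k (site_dp S%:P (x 0 k)%:P (x 0 k)^-1%:P) n.+1 0 0.

(** The derivation is x d/dx rather than d/dx, which absorbs the weight [x 0 k] of the bracket. *)
Definition dT_dx x p (k : 'I_n.+1) : {poly R} :=
  variation (sites x p) k
    (site_dx S%:P (p 0 k)%:P (x 0 k)%:P (x 0 k)^-1%:P) n.+1 0 0.

Lemma coords_shift x (k : 'I_n.+1) h m :
  (m < n.+1)%N ->
  coords (h *: delta_mx 0 k + x) m = (if (k : nat) == m then h + x 0 k else coords x m).
Proof.
move=> lt_mn; rewrite /coords !mxE eqxx /=.
have [<-|ne] := eqVneq (k : nat) m; first by rewrite inord_val eqxx mulr1.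
by rewrite -val_eqE /= inordK // eq_sym (negPf ne) mulr0 add0r.
Qed.

Lemma T11_dp x p (k : 'I_n.+1) h :
  T11 S x (h *: delta_mx 0 k + p) = T11 S x p + h *: dT_dp x p k.
Proof.
rewrite /T11 !monodromyE /dT_dp.
set E := site_dp _ _ _.
rewrite (@transfer_perturb _ (sites x p) _ k (h%:P *: E + 0 *: 0)).
  by rewrite variationP scale0r addr0; set T := transfer _ _; rewrite !mxE mul_polyC.
move=> m lt_mn; rewrite /sites /chain coords_shift //.
case: eqP => [<-|_]; last by rewrite addr0.
rewrite /coords inord_val scale0r addr0.
apply/matrixP => i j; rewrite !mxE polyCD.
by case: ifP => _; case: ifP => _; ring.
Qed.

(** [D1] and [D2] are the responses to the entries of site [k] containing [x 0 k] and its
    inverse. *)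
Lemma T11_dx x p (k : 'I_n.+1) : x 0 k != 0 ->
  exists D1 D2 : {poly R},
    dT_dx x p k = x 0 k *: D1 - (x 0 k)^-1 *: D2 /\
    forall h, T11 S (h *: delta_mx 0 k + x) p =
      T11 S x p + h *: D1 + ((x 0 k + h)^-1 - (x 0 k)^-1) *: D2.
Proof.
move=> xk0.
pose E1 : 'M[{poly R}]_2 := mx2 0 0 (1 + S%:P * (p 0 k)%:P) 0.
pose E2 : 'M[{poly R}]_2 := mx2 0 (1 - S%:P * (p 0 k)%:P) 0 0.
pose V E := variation (sites x p) k E n.+1.
exists (V E1 0 0), (V E2 0 0); split.
  rewrite /dT_dx.
  have -> : site_dx S%:P (p 0 k)%:P (x 0 k)%:P (x 0 k)^-1%:P =
      (x 0 k)%:P *: E1 + (- (x 0 k)^-1%:P) *: E2.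
    apply/matrixP => i j; rewrite !mxE.
    by case: ifP => _; case: ifP => _; ring.
  by rewrite variationP !mxE mulNr !mul_polyC.
move=> h; rewrite /T11 !monodromyE.
set c := _ - _.
rewrite (@transfer_perturb _ (sites x p) _ k (h%:P *: E1 + c%:P *: E2)).
  by rewrite variationP; set T := transfer _ _; rewrite !mxE !mul_polyC addrA.
move=> m lt_mn; rewrite /sites /chain coords_shift //.
case: eqP => [<-|_]; last by rewrite addr0.
rewrite /coords inord_val /c (addrC h).
apply/matrixP => i j; rewrite !mxE polyCD polyCB.
by case: ifP => _; case: ifP => _; ring.
Qed.

Lemma derive_hamiltonian_p x p (k : 'I_n.+1) i :
  'D_(delta_mx 0 k) (fun q => hamiltonian S i x q) p =
  signed_coef n.+1 (dT_dp x p k) i.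
Proof.
(* The dependence on momenta is affine: the inverse term gets coefficient 0, at the arbitrary
   nonzero base point 1. *)
rewrite (@derive_affine_inv _ _ _ _ _ 1 (signed_coef n.+1 (dT_dp x p k) i) 0).
- by rewrite mul0r subr0.
- exact: oner_neq0.
by move=> h; rewrite /hamiltonian T11_dp /signed_coef coefD coefZ; ring.
Qed.

Lemma derive_hamiltonian_x x p (k : 'I_n.+1) i : x 0 k != 0 ->
  x 0 k * 'D_(delta_mx 0 k) (fun y => hamiltonian S i y p) x =
  signed_coef n.+1 (dT_dx x p k) i.
Proof.
move=> xk0; have [D1 [D2 [-> T11E]]] := T11_dx p xk0.
rewrite (@derive_affine_inv _ _ _ _ _ (x 0 k)
  (signed_coef n.+1 D1 i) (signed_coef n.+1 D2 i)) //.
  by rewrite /signed_coef coefB !coefZ; field.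
by move=> h; rewrite /hamiltonian T11E /signed_coef !(coefD, coefZ); ring.
Qed.

(* {T11(u), T11(v)} with u the inner indeterminate of {poly {poly R}} and v the
   outer one. *)
Lemma T11_involution x p : (forall k, x 0 k != 0) ->
  \sum_(k < n.+1) ((dT_dp x p k)%:P * map_poly polyC (dT_dx x p k)
                 - (dT_dx x p k)%:P * map_poly polyC (dT_dp x p k)) = 0.
Proof.
move=> x_neq0; set F := \sum_(k < _) _.
(* The Yangian relation controls the bracket times u - v, which is cancelled in an integral
   domain. *)
have uv_neq0 : ('X%:P - 'X : {poly {poly R}}) != 0.
  by rewrite -opprB oppr_eq0 polyXsubC_eq0.
apply: (mulfI uv_neq0); rewrite mulr0.
pose cc (a : R) : {poly {poly R}} := a%:P%:P.
pose y k := coords x k; pose q k := coords p k.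
pose L (w : {poly {poly R}}) k := site w (cc S) (cc (q k)) (cc (y k)) (cc (y k)^-1).
pose P k := site_dp (cc S) (cc (y k)) (cc (y k)^-1).
pose X k := site_dx (cc S) (cc (q k)) (cc (y k)) (cc (y k)^-1).
(* This holds for every natural [s]: out of range, [coords] still returns a coordinate of [x]. *)
have cc_inv s : cc (y s) * cc (y s)^-1 = 1.
  by rewrite /cc -!polyCM divff // x_neq0.
have map1 E k : (variation (sites x p) k E n.+1 0 0)%:P =
    variation (L 'X%:P) k (map_mx polyC E) n.+1 0 0.
  transitivity (map_mx polyC (variation (sites x p) k E n.+1) 0 0).
    by rewrite [RHS]mxE.
  rewrite map_variation.
  by congr (variation _ _ _ _ _ _); apply/funext => s; rewrite map_site.
have map2 E k : map_poly polyC (variation (sites x p) k E n.+1 0 0) =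
    variation (L 'X) k (map_mx (map_poly polyC) E) n.+1 0 0.
  transitivity (map_mx (map_poly polyC) (variation (sites x p) k E n.+1) 0 0).
    by rewrite [RHS]mxE.
  rewrite map_variation.
  congr (variation _ _ _ _ _ _); apply/funext => s.
  by rewrite map_site /= map_polyX !map_polyC.
pose V w E k := variation (L w) k (E k) n.+1 0 0.
have rtt : ('X%:P - 'X) * \sum_(k < n.+1)
    (V 'X%:P P k * V 'X X k - V 'X%:P X k * V 'X P k) = 0.
  (* With all four indices equal, the right-hand side is a commutator of scalars. *)
  apply: etrans (rtt_transfer n.+1 _ 0 0 0 0) _; last by rewrite mulrC subrr.
  by move=> s i j k l; apply: rtt_site.
rewrite -[RHS]rtt /F; congr (_ * _); refine (eq_bigr _ _) => k _.
have qE : p 0 k = q k by rewrite /q /coords inord_val.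
have yE : x 0 k = y k by rewrite /y /coords inord_val.
rewrite /dT_dp /dT_dx !map1 !map2 !map_site_dp !map_site_dx /= !map_polyC /=.
by rewrite qE yE.
Qed.

Lemma poisson_hamiltonian i j x p : in_phase_space x p ->
  poisson (hamiltonian S i) (hamiltonian S j) x p = 0.
Proof.
move=> x_neq0; rewrite /poisson.
pose a := (n.+1 - i)%N; pose b := (n.+1 - j)%N.
(* The outer index [b] selects the power of v and belongs to [j]; the inner index [a] selects that
   of u and belongs to [i]. *)
have := congr1 (fun F : {poly {poly R}} => (-1) ^+ i * (-1) ^+ j * F`_b`_a)
  (T11_involution p x_neq0).
rewrite !coef0 mulr0; apply: etrans.
rewrite !coef_sum mulr_sumr; apply: eq_bigr => k _.
rewrite !(coefB, coefCM, coef_map) /= !coefMC.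
set f := hamiltonian S i; set g := hamiltonian S j.
transitivity ('D_(delta_mx 0 k) (f x) p * (x 0 k * 'D_(delta_mx 0 k) (g^~ p) x)
  - (x 0 k * 'D_(delta_mx 0 k) (f^~ p) x) * 'D_(delta_mx 0 k) (g x) p).
  by rewrite mulrBr mulrCA [in X in _ - X]mulrA.
rewrite !derive_hamiltonian_p !derive_hamiltonian_x //.
rewrite /signed_coef -/a -/b; ring.
Qed.

End Involution.

Theorem theorem3p5 (R : realType) (n : nat) (S : R) (n_ge1 : (1 <= n)%N) :
  (forall (i j : 'I_n.+1) (x p : 'rV[R]_n), in_phase_space x p ->
     poisson (hamiltonian S i) (hamiltonian S j) x p = 0) /\
  (forall x p : 'rV[R]_n, in_phase_space x p ->
     [/\ T11 S x p =
           \sum_(i < n.+1) ((-1) ^+ i * hamiltonian S i x p) *: 'X^(n - i),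
         (forall i : 'I_n.+1,
            hamiltonian S i x p = signed_coef n (char_poly (Lax S x p)) i)
       & char_poly (Lax S x p) = T11 S x p]).
Proof.
case: n n_ge1 => // n _; split=> [i j x p|x p x_neq0].
  exact: poisson_hamiltonian.
have charE : char_poly (Lax S x p) = T11 S x p.
  have [k _|T00 _] := @transfer_char_poly _ S (coords x) (coords p) n.+1.
    exact: x_neq0.
  rewrite /T11 monodromyE T00; congr char_poly; apply/matrixP => i j.
  by rewrite !mxE /coords !inord_val.
split=> // [|i]; last by rewrite charE.
(* The degree bound comes from the characteristic polynomial; there are now [n.+1] sites, hence
   [n.+2] coefficients. *)
have size_T : (size (T11 S x p) <= n.+2)%N by rewrite -charE size_char_poly.
have {1}-> : T11 S x p = \poly_(i < n.+2) (T11 S x p)`_i.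
  apply/polyP => i; rewrite coef_poly; case: ltnP => // le_i.
  by rewrite nth_default // (leq_trans size_T).
rewrite poly_def (reindex_inj rev_ord_inj); apply: eq_bigr => i _.
by rewrite /hamiltonian /signed_coef mulrA -expr2 sqrr_sign mul1r /= subSS.
Qed.
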